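(* Let $n, n_1, n_2$ be integers satisfying $1\leq n_1<n_2\leq n$ and $n\geq 9$. Then there exists a Hamilton path from $n_1$ to $n_2$ in the prime difference graph $G_n$ (that is, $G_n$ is $(n_1,n_2)$-feasible).
   Context: For a positive integer $n$, the prime difference graph $G_n$ of order $n$ is the graph with vertex set $\{1,2,\dots,n\}$ in which two vertices $u,v$ are adjacent if and only if $|u-v|$ is a prime number. A Hamilton path is a path visiting each vertex of the graph exactly once. $G_n$ is called $(n_1,n_2)$-feasible if there exists a Hamilton path in $G_n$ with end-vertices $n_1$ and $n_2$. *)

(* Defs.v *)
From mathcomp Require Import all_boot all_order all_algebra.

Set Implicit Arguments.
Unset Strict Implicit.
Unset Printing Implicit Defensive.

(* A finite graph on a type T is given by a duplicate-free sequence listing its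
   vertices together with a symmetric irreflexive adjacency relation. *)

(* The walk is x :: p, from x to last x p; perm_eq with the vertex list says
   that each vertex is visited exactly once and nothing else is visited. *)
Definition hamilton_path (T : eqType) (V : seq T) (adj : rel T)
    (x y : T) (p : seq T) : Prop :=
  [/\ path adj x p, perm_eq (x :: p) V & last x p = y].

Definition pdg_vertices (n : nat) : seq nat := iota 1 n.

(* The subtraction under the bars is the one of int, not the truncated one. *)
Definition pdg_adj (n : nat) : rel nat :=
  fun u v => [&& u \in pdg_vertices n, v \in pdg_vertices n & prime `|u - v|].

Definition feasible (n n1 n2 : nat) : Prop :=
  exists p : seq nat, hamilton_path (pdg_vertices n) (pdg_adj n) n1 n2 p.

(* Main.v *)
Require Import Defs.
From mathcomp Require Import all_boot all_order all_algebra.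
From mathcomp Require Import zify.

(** Strong induction on [n], for arbitrary distinct ends [x] and [y], which by
    reversal may be taken with [x < y].  The range from 1 to [n] is the range
    from 1 to [m] followed by a translate of the range from 1 to [n - m], and
    when both parts have at least nine elements, both are already known to be
    traceable between any two distinct vertices.

    - If some such cut [m] separates [x] from [y], travel through the lower part
      from [x] to its top (or, if [x] is the top, to the vertex below), jump
      across the cut by a difference 2 or 3, and travel through the upper part
      to [y] ([traceable_cat], [crossing]).
    - If [x] and [y] are both at most 9, cut at 9.  Remove the first edge [x v]
      of a Hamilton path of the lower part and go from [x] to [v] through the
      whole upper part instead ([traceable_detour]).  This is possible for any
      [x <> v]: the nine vertices of the lower part can be matched by prime
      differences with the nine lowest vertices of the upper part
      ([exit_vertex]), and the upper part is traceable between the two partners.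
    - If [x] and [y] are both among the last nine vertices, the reflection
      [u |-> n + 1 - u] leads back to the previous case.

    When [n >= 18] one of these cases applies.  For [n] from 9 to 17 a
    depth-first search finds all the paths ([reaches]); trying the vertices in
    increasing order makes it almost free of backtracking. *)

Set Implicit Arguments.
Unset Strict Implicit.
Unset Printing Implicit Defensive.

(** * Hamilton paths with prescribed ends *)

Definition traceable (T : eqType) (V : seq T) (adj : rel T) (x y : T) : Prop :=
  exists p, hamilton_path V adj x y p.

Lemma traceable_sym (T : eqType) (V : seq T) (adj : rel T) x y :
  symmetric adj -> traceable V adj x y -> traceable V adj y x.
Proof.
move=> adjC [p [adj_p pV <-]].
exists (rev (belast x p)); split.
- by rewrite rev_path (eq_path (e' := adj)) // => u v; rewrite adjC.
- by rewrite -rev_rcons -lastI perm_rev.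
- by case: p {adj_p pV} => //= z p; rewrite rev_cons last_rcons.
Qed.

Lemma traceable_map (T T' : eqType) (f : T -> T') (V : seq T) (V' : seq T')
    (adj : rel T) (adj' : rel T') x y :
  {in V &, {homo f : u v / adj u v >-> adj' u v}} -> perm_eq (map f V) V' ->
  traceable V adj x y -> traceable V' adj' (f x) (f y).
Proof.
move=> homo_f fV [p [adj_p pV <-]].
exists (map f p); split; last by rewrite last_map.
- apply: (homo_path_in homo_f) adj_p.
  by apply/allP => u; rewrite (perm_mem pV).
- by rewrite -map_cons (perm_trans _ fV) // perm_map.
Qed.

Lemma traceable_cat (T : eqType) (V W : seq T) (adj : rel T) x a b y :
  traceable V adj x a -> adj a b -> traceable W adj b y ->
  traceable (V ++ W) adj x y.
Proof.
move=> [p [adj_p pV last_p]] ab [q [adj_q qW last_q]].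
exists (p ++ b :: q); split.
- by rewrite cat_path /= last_p adj_p ab.
- by rewrite -cat_cons perm_cat.
- by rewrite last_cat.
Qed.

(** The first edge of the path, from [x] to [v], is the one that is traded for
    the passage through [W]; [v] does not depend on [W], so that the entrance
    [c] and the exit [d] can be chosen once [v] is known. *)
Lemma traceable_detour (T : eqType) (V : seq T) (adj : rel T) x y :
  uniq V -> x != y -> traceable V adj x y ->
  exists2 v, (v \in V) && (v != x) &
    forall W c d, adj x c -> traceable W adj c d -> adj d v ->
      traceable (V ++ W) adj x y.
Proof.
move=> uniqV xy [[|v q] [/= adj_p pV last_p]].
  by rewrite last_p eqxx in xy.
have /and3P[/= x_vq _ _] : uniq [:: x, v & q] by rewrite (perm_uniq pV).
exists v.
  rewrite -(perm_mem pV) !inE eqxx orbT /=.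
  by apply: contraNneq x_vq => ->; rewrite mem_head.
move=> W c d xc [r [adj_r rW last_r]] dv.
exists ((c :: r) ++ v :: q); split; last by rewrite last_cat.
- by case/andP: adj_p => _ adj_q; rewrite /= cat_path /= xc adj_r last_r dv.
- apply/permP => P; move/permP/(_ P): pV; move/permP/(_ P): rW.
  by rewrite /= !count_cat /=; lia.
Qed.

(** * Prime differences *)

Definition prime_diff : rel nat := fun u v => prime `|u - v|.

Lemma prime_diffE u v : prime_diff u v = prime ((u - v) + (v - u)).
Proof. by congr prime; lia. Qed.

Lemma prime_diffC : symmetric prime_diff.
Proof. by move=> u v; rewrite /prime_diff distnC. Qed.

Definition pdg_traceable (n x y : nat) := traceable (iota 1 n) prime_diff x y.

Lemma pdg_traceable_feasible n x y : pdg_traceable n x y -> feasible n x y.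
Proof.
move=> [p [adj_p pV last_p]]; exists p; split=> //.
apply: (@sub_in_path _ (mem (iota 1 n)) prime_diff) adj_p => [u v u_n v_n uv|].
  by rewrite /pdg_adj /pdg_vertices u_n v_n.
by apply/allP => u; rewrite (perm_mem pV).
Qed.

Lemma pdg_traceable_shift m k x y :
  pdg_traceable k x y ->
  traceable (iota m.+1 k) prime_diff (m + x) (m + y).
Proof.
move=> xy_tr; apply: (traceable_map (f := addn m) _ _ xy_tr).
- by move=> u v _ _; rewrite /prime_diff distnDl.
- by rewrite -[m.+1]addn1 iotaDl.
Qed.

Lemma pdg_traceable_reflect n x y :
  pdg_traceable n x y -> pdg_traceable n (n.+1 - x) (n.+1 - y).
Proof.
move=> xy_tr; apply: (traceable_map (f := subn n.+1) _ _ xy_tr).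
- move=> u v; rewrite !mem_iota !prime_diffE => u_n v_n.
  by congr (is_true (prime _)); lia.
- apply: uniq_perm; rewrite ?iota_uniq //.
    by rewrite map_inj_in_uniq ?iota_uniq // => u v; rewrite !mem_iota; lia.
  move=> u; apply/mapP/idP => [[v]|]; rewrite !mem_iota; first by lia.
  by move=> u_n; exists (n.+1 - u); rewrite ?mem_iota; lia.
Qed.

(** * Exhaustive search for small orders *)

(** Cheap to evaluate, and equivalent to [prime_diff] on vertices up to 17. *)
Definition near u v := (u - v) + (v - u) \in [:: 2; 3; 5; 7; 11; 13].

Lemma near_prime_diff u v : near u v -> prime_diff u v.
Proof.
rewrite /near prime_diffE; move: (_ + _).
by apply/allP.
Qed.

(** Search for a path from [x] through all of [V], of size [k], to [y].  Unlike
    [has], [find] tests its branches with a conditional, so that under any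
    evaluation strategy the search stops at the first success. *)
Fixpoint reaches k x y V : bool :=
  if k is k'.+1 then
    find (fun z => if near x z then reaches k' z y (rem z V) else false) V
      < size V
  else if V is [::] then near x y else false.

Lemma reaches_traceable k x y V :
  reaches k x y V -> traceable [:: x, y & V] prime_diff x y.
Proof.
elim: k x V => [|k IHk] x V /=.
  case: V => // xy; exists [:: y]; split=> //=.
  by rewrite near_prime_diff.
rewrite -has_find => /hasP[z zV]; case: ifP => // xz /IHk[p [adj_p pV last_p]].
exists (z :: p); split=> //=; first by rewrite near_prime_diff.
rewrite perm_cons (perm_trans pV) //.
rewrite -[z :: _]/([:: z] ++ [:: y] ++ _) perm_catCA perm_cons.
by rewrite perm_sym perm_to_rem.
Qed.

Definition all_reach n :=
  all (fun x => all (fun y => reaches n.-2 x y (rem y (rem x (iota 1 n))))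
                    (iota x.+1 (n - x)))
      (iota 1 n).

Lemma all_reach_small : all all_reach (iota 9 9).
Proof. by vm_compute. Qed.

Lemma pdg_traceable_small n x y :
  9 <= n < 18 -> 1 <= x < y -> y <= n -> pdg_traceable n x y.
Proof.
move=> n_small xy yn; have /allP/(_ n) := all_reach_small.
rewrite mem_iota => /(_ n_small)/allP/(_ x).
rewrite mem_iota => /(_ ltac:(lia))/allP/(_ y).
rewrite mem_iota => /(_ ltac:(lia))/reaches_traceable[p [adj_p pV last_p]].
exists p; split=> //; apply: (perm_trans pV); rewrite perm_sym.
apply: (perm_trans (y := x :: rem x (iota 1 n))).
  by rewrite perm_to_rem // mem_iota; lia.
rewrite perm_cons perm_to_rem // rem_filter ?iota_uniq //.
by rewrite mem_filter /= mem_iota; lia.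
Qed.

(** * Connecting two ranges *)

(** The ends [a] and [b] of the jump must differ from [x] and [y], because the
    path through each part needs two distinct ends. *)
Lemma crossing m x y :
  1 < m -> x <= m -> m < y ->
  exists a b : nat, [/\ a != x, 1 <= a <= m, b != y, m < b <= m + 3 & near a b].
Proof.
move=> m_gt1 xm my.
have near_plus (a d : nat) : d \in [:: 2; 3] -> near a (a + d).
  rewrite /near !inE subnDA subnn sub0n addKn add0n.
  by move=> /orP[]/eqP->.
have [a [ax am a_top]] : exists a : nat, [/\ a != x, 1 <= a <= m & m <= a.+1].
  by have [->|xm_neq] := eqVneq x m; [exists m.-1 | exists m]; split; lia.
(* A difference of 2 suffices unless it would end in [y]. *)
have [y_a2|y_a2] := eqVneq y (a + 2).
- by exists a, (a + 3); split; rewrite ?near_plus //; lia.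
- by exists a, (a + 2); split; rewrite ?near_plus //; lia.
Qed.

(** A perfect matching, by prime differences, between the vertices 1 to 9 and
    the vertices 10 to 18. *)
Definition exit_vertex u := nth 0 [:: 0; 12; 15; 16; 17; 18; 13; 14; 10; 11] u.

Lemma exit_vertexP u :
  1 <= u <= 9 -> (9 < exit_vertex u <= 18) && near u (exit_vertex u).
Proof.
pose ok u := (9 < exit_vertex u <= 18) && near u (exit_vertex u).
have /allP/(_ u) : all ok (iota 1 9) by [].
by rewrite mem_iota => ok_u u9; apply: ok_u; lia.
Qed.

Lemma exit_vertex_inj u v :
  1 <= u <= 9 -> 1 <= v <= 9 -> exit_vertex u = exit_vertex v -> u = v.
Proof.
move=> u9 v9 /eqP; rewrite /exit_vertex nth_uniq //=; [|lia..].
by move/eqP.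
Qed.

Lemma pdg_traceable_ge9 n x y :
  9 <= n -> 1 <= x <= n -> 1 <= y <= n -> x != y -> pdg_traceable n x y.
Proof.
elim/ltn_ind: n x y => n IHn x y n_ge9.
wlog xy : x y / x < y => [hwlog xn yn neq_xy|xn yn _].
  case: (ltngtP x y) (neq_xy) => // lt_xy _; first exact: hwlog.
  by apply: (traceable_sym prime_diffC); apply: hwlog; rewrite 1?eq_sym.
have [n_small|n_ge18] := ltnP n 18.
  by apply: pdg_traceable_small; lia.
have IHtail m c d : 9 <= m -> 9 <= n - m -> m < c <= n -> m < d <= n ->
    c != d -> traceable (iota m.+1 (n - m)) prime_diff c d.
  move=> m9 nm9 cn dn cd; have [mc md] : m <= c /\ m <= d by lia.
  rewrite -(subnKC mc) -(subnKC md).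
  by apply: pdg_traceable_shift; apply: IHn; lia.
have low u v : 1 <= u <= 9 -> 1 <= v <= 9 -> u != v -> pdg_traceable n u v.
  move=> u9 v9 uv; have uv_tr : pdg_traceable 9 u v by apply: IHn; lia.
  have [w /andP[w9 wu] detour] := traceable_detour (iota_uniq 1 9) uv uv_tr.
  rewrite mem_iota in w9.
  have /andP[cn uc] := exit_vertexP u9.
  have /andP[dn wd] := exit_vertexP w9.
  rewrite /pdg_traceable -(subnKC n_ge9) iotaD.
  apply: (detour _ _ (exit_vertex w) (near_prime_diff uc)).
    apply: IHtail; try lia.
    by apply: contra_neq wu => /(exit_vertex_inj u9 w9)->.
  by rewrite prime_diffC near_prime_diff.
have [y9|y_gt9] := leqP y 9; first by apply: low; lia.
have [x_high|x_le] := ltnP (n - 9) x.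
  have [xn' yn'] : x <= n.+1 /\ y <= n.+1 by lia.
  rewrite -(subKn xn') -(subKn yn').
  by apply: pdg_traceable_reflect; apply: low; lia.
(* The least admissible cut above [x]. *)
pose m := maxn 9 x.
have [||| a [b [ax am b_y bm ab]]] := @crossing m x y; try (rewrite /m; lia).
have mn : m <= n by rewrite /m; lia.
rewrite /pdg_traceable -(subnKC mn) iotaD.
apply: traceable_cat (near_prime_diff ab) _.
- by apply: IHn; rewrite ?/m; lia.
- by apply: IHtail; rewrite ?/m; lia.
Qed.

Theorem theorem2p6 (n n1 n2 : nat) (h1 : 1 <= n1) (h12 : n1 < n2)
  (h2 : n2 <= n) (hn : 9 <= n) : feasible n n1 n2.
Proof.
apply: pdg_traceable_feasible.
by apply: pdg_traceable_ge9; lia.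
Qed.
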